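(* Let $\mathcal{X}$ be a complete separable metric space. Let $\mathcal{F}$ be a countable family of Borel measurable functions $f:\mathcal{X}\to\mathbb{R}$ that is uniformly bounded, i.e. there is a constant $M<\infty$ with $|f(x)|\le M$ for all $x\in\mathcal{X}$ and $f\in\mathcal{F}$. If $\dim_\gamma(\mathcal{F})<\infty$ for some $\gamma>0$, then $\Gamma(\mathcal{F}:\mathbf{X})\le 10\gamma$ for every stationary ergodic process $\mathbf{X}$ with values in $\mathcal{X}$. In particular, if $\dim_\gamma(\mathcal{F})<\infty$ for every $\gamma>0$, then $\Gamma(\mathcal{F}:\mathbf{X})=0$ for every stationary ergodic process $\mathbf{X}$ with values in $\mathcal{X}$.
   Context: Discrepancy: for a stationary ergodic process $\mathbf{X}=X_1,X_2,\ldots$ with values in $\mathcal{X}$ and $m\ge1$, $\Gamma_m(\mathcal{F}:\mathbf{X})=\sup_{f\in\mathcal{F}}\left|\frac1m\sum_{i=1}^m f(X_i)-Ef(X)\right|$, where $X$ has the common (marginal) distribution of the $X_i$. For a stationary ergodic process $\mathbf{X}$ and a countable uniformly bounded family $\mathcal{F}$, there is (by the subadditive ergodic theorem) a non-negative constant $\Gamma(\mathcal{F}:\mathbf{X})$ such that $\Gamma_m(\mathcal{F}:\mathbf{X})\to\Gamma(\mathcal{F}:\mathbf{X})$ with probability one as $m\to\infty$; this constant is called the asymptotic discrepancy of $\mathcal{F}$ on $\mathbf{X}$. Gap dimension: let $\gamma>0$. The family $\mathcal{F}$ is said to $\gamma$-shatter a finite set $D\subseteq\mathcal{X}$ if there is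 an $\alpha\in\mathbb{R}$ such that for every $D_0\subseteq D$ there exists $f\in\mathcal{F}$ with $f(x)>\alpha+\gamma$ for $x\in D_0$ and $f(x)<\alpha-\gamma$ for $x\in D\setminus D_0$. The gap dimension $\dim_\gamma(\mathcal{F})$ is the largest $k$ such that $\mathcal{F}$ $\gamma$-shatters some set of cardinality $k$; if $\mathcal{F}$ $\gamma$-shatters sets of arbitrarily large finite cardinality, then $\dim_\gamma(\mathcal{F})=+\infty$. *)

(* Defs.v *)
From HB Require Import structures.
From mathcomp Require Import all_boot all_order all_algebra.
From mathcomp Require Import all_classical all_reals all_analysis.
Set Implicit Arguments.
Unset Strict Implicit.
Unset Printing Implicit Defensive.
Import Order.TTheory GRing.Theory Num.Theory.
Import numFieldNormedType.Exports.
Local Open Scope classical_set_scope.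
Local Open Scope ring_scope.

(* The library's completeness and measurability interfaces are over pointed
   types; a space carrying a random variable is nonempty, so this costs nothing
   here. *)
#[short(type="completeMetricType")]
HB.structure Definition CompleteMetric (R : numDomainType) :=
  {T of Complete T & Metric R T}.

Definition separable (T : topologicalType) : Prop :=
  exists2 D : set T, countable D & dense D.

Notation borel T := (g_sigma_algebraType (@open T)).

Section process.
Context {d dT : measure_display} {Omega : measurableType d}
  {T : measurableType dT} {R : realType} (P : probability Omega R).

Definition shift (u : nat -> T) : nat -> T := fun i => u i.+1.

(* Product sigma-algebra on the path space T^nat. *)
Definition path_measurable : set_system (nat -> T) :=
  <<s [set A | exists i : nat, exists2 B : set T,
         measurable B & A = [set u | B (u i)]] >>.

(* X i stands for X_(i+1). *)
Definition sample_path (X : nat -> {RV P >-> T}) (w : Omega) : nat -> T :=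
  fun i => X i w.

Definition stationary (X : nat -> {RV P >-> T}) : Prop :=
  forall A, path_measurable A ->
    P (sample_path X @^-1` (shift @^-1` A)) = P (sample_path X @^-1` A).

Definition ergodic (X : nat -> {RV P >-> T}) : Prop :=
  forall A, path_measurable A -> shift @^-1` A = A ->
    P (sample_path X @^-1` A) = 0%E \/ P (sample_path X @^-1` A) = 1%E.

(* Only used for uniformly bounded F, where the supremum is finite; for an
   empty F it is 0. By stationarity every X i has the law of X 0. *)
Definition discrepancy (F : set (T -> R)) (X : nat -> {RV P >-> T})
    (m : nat) (w : Omega) : R :=
  sup [set `| m%:R^-1 * (\sum_(i < m) f (X i w)) - fine 'E_P[f \o X 0%N] |
      | f in F].

(* The almost sure limit is unique, so this determines c; for a stationary
   ergodic X and a countable uniformly bounded F such a c exists by the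
   subadditive ergodic theorem. *)
Definition is_asymptotic_discrepancy (F : set (T -> R))
    (X : nat -> {RV P >-> T}) (c : R) : Prop :=
  0 <= c /\ {ae P, forall w, discrepancy F X m w @[m --> \oo] --> c}.

End process.

Section gap_dimension.
Context {T : Type} {R : realType}.

Definition shatters (gamma : R) (F : set (T -> R)) (D : set T) : Prop :=
  exists alpha : R, forall D0 : set T, D0 `<=` D ->
    exists2 f, F f &
      (forall x, D0 x -> alpha + gamma < f x) /\
      (forall x, (D `\` D0) x -> f x < alpha - gamma).

(* Takes the value -oo when F is empty: then not even set0 is shattered. *)
Definition gap_dim (gamma : R) (F : set (T -> R)) : \bar R :=
  ereal_sup [set (k%:R)%:E | k in
    [set k : nat | exists2 D : set T, (D #= `I_k)%card & shatters gamma F D]].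

End gap_dimension.

(* Main.v *)
(* It suffices to find a finite measurable partition q such that, uniformly in f
   in F, f oscillates by at most 4 gamma on each cell, off a null set and off a
   union of cells of small measure: Birkhoff's theorem for the finitely many
   cells then controls all f in F at once, with a limiting error of at most
   8 gamma plus a small term.

   At a fixed level alpha, call a set split by f if f > alpha + gamma and
   f < alpha - gamma both have positive measure in it. Suppose that for every
   finite partition some f splits cells of total measure at least delta. Take an
   ultrafilter on the set of these f containing, for every partition q, the f
   that split cells of q of total measure at least delta. Removing a maximal
   countable union of sets that are eventually not split (up to finite
   partitions) leaves a set B of positive measure, all of whose subsets of
   positive measure are eventually split. Hence finitely many such subsets can
   be split by one and the same f, and iterating from B yields n functions
   realizing all 2^n patterns of values above and below the gap. With n = 2^k
   this gives k points that F gamma-shatters, so the gap dimension is infinite.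
   As F is bounded, finitely many levels suffice, and the partitions obtained
   for them have a common refinement. *)
Require Import Defs.
From HB Require Import structures.
From mathcomp Require Import all_boot all_order all_algebra.
From mathcomp Require Import all_classical all_reals all_analysis.
From mathcomp Require Import measurable_realfun.
From mathcomp Require Import ring lra.
Import Order.TTheory GRing.Theory Num.Theory.
Import numFieldNormedType.Exports.
Local Open Scope classical_set_scope.
Local Open Scope ring_scope.
Set Implicit Arguments.
Unset Strict Implicit.
Unset Printing Implicit Defensive.

(** * Real-valued probabilities and an exhaustion argument *)

Section real_probability.
Context d (T : measurableType d) (R : realType) (P : probability T R).

Definition prob (A : set T) : R := fine (P A).

Lemma probE A : measurable A -> P A = (prob A)%:E.
Proof. by move=> mA; rewrite fineK// fin_num_measure. Qed.

Lemma prob_ge0 A : 0 <= prob A.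
Proof. exact: fine_ge0. Qed.

Lemma prob0 : prob set0 = 0.
Proof. by rewrite /prob measure0. Qed.

Lemma le_prob A B : measurable A -> measurable B -> A `<=` B ->
  prob A <= prob B.
Proof.
by move=> mA mB AB; rewrite -lee_fin -!probE// le_measure ?inE.
Qed.

Lemma prob_le1 A : measurable A -> prob A <= 1.
Proof. by move=> mA; rewrite -lee_fin -probE// probability_le1. Qed.

Lemma probC A : measurable A -> prob (~` A) = 1 - prob A.
Proof.
move=> mA; apply: EFin_inj.
by rewrite -probE ?probability_setC ?probE//; exact: measurableC.
Qed.

Lemma probU A B : measurable A -> measurable B -> A `&` B = set0 ->
  prob (A `|` B) = prob A + prob B.
Proof.
move=> mA mB AB; apply: EFin_inj; rewrite EFinD -!probE ?measureU//.
exact: measurableU.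
Qed.

Lemma le_probU A B : measurable A -> measurable B ->
  prob (A `|` B) <= prob A + prob B.
Proof.
move=> mA mB; rewrite -lee_fin EFinD -!probE ?measureU2//.
exact: measurableU.
Qed.

Lemma prob_eq0 A : measurable A -> prob A = 0 -> P A = 0%E.
Proof. by move=> mA A0; rewrite probE// A0. Qed.

Lemma prob_bigcup_approx (A : (set T)^nat) (e : R) :
  (forall n, measurable (A n)) -> nondecreasing_seq A -> 0 < e ->
  exists n, prob (\bigcup_n A n) - e < prob (A n).
Proof.
move=> mA ndA e0.
have mU : measurable (\bigcup_n A n) by exact: bigcupT_measurable.
have : P (A n) @[n --> \oo] --> (prob (\bigcup_n A n))%:E.
  by rewrite -probE//; exact: nondecreasing_cvg_mu.
move=> /fine_cvgP[_].
move=> /cvgrPdist_lt/(_ _ e0)[N _ /(_ N (leqnn N))].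
rewrite /= -/(prob _) => /ltr_normlP[_ h]; exists N; lra.
Qed.

(** [A n] is a finite union of members of [N], of measure within [1 / (n + 1)] of the supremum. If
    [E] misses all of them, [E] united with [A n] still obeys the supremum, so [prob E] is below
    [1 / (n + 1)]. *)
Lemma exhaustion (N : set (set T)) : (forall A, N A -> measurable A) ->
  N set0 -> (forall A B, N A -> N B -> N (A `|` B)) ->
  exists A : (set T)^nat, [/\ forall n, N (A n), nondecreasing_seq A &
    forall E, N E -> E `&` \bigcup_n A n = set0 -> prob E = 0].
Proof.
move=> mN N0 NU; pose S := [set prob A | A in N].
have hS : has_sup S.
  split; first by exists (prob set0), set0.
  by exists 1 => _ [A NA <-]; exact/prob_le1/mN.
have ch n : {A | N A /\ sup S - n.+1%:R^-1 < prob A}.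
  have n0 : 0 < n.+1%:R^-1 :> R by rewrite invr_gt0.
  apply: cid; have [_ [A NA <-] h] := sup_adherent n0 hS.
  by exists A.
pose A n := \big[setU/set0]_(k < n.+1) sval (ch k).
have NA n : N (A n).
  rewrite /A; elim: n.+1 => [|m IH]; first by rewrite big_ord0.
  by rewrite big_ord_recr/=; apply: NU => //; case: (svalP (ch m)).
exists A; split => //.
  apply/nondecreasing_seqP=> n; apply/subsetPset.
  by rewrite /A (big_ord_recr n.+1)/=; exact: subsetUl.
move=> E NE EA; apply/eqP; rewrite eq_le prob_ge0 andbT.
suff h (e : R) : 0 < e -> prob E <= e.
  by apply/ler_addgt0Pl => e e0; rewrite addr0; exact: h.
move=> e0.
have [n ne] : exists n, n.+1%:R^-1 < e :> R.
  by have [m _ /(_ m (leqnn m))] := near_infty_natSinv_lt (PosNum e0); exists m.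
have mE := mN _ NE; have mA := mN _ (NA n).
have EAn : E `&` A n = set0.
  by rewrite -subset0 -EA; apply: setIS; exact: bigcup_sup.
have : prob (E `|` A n) <= sup S.
  by apply: sup_ubound; [case: hS|exists (E `|` A n) => //; exact: NU].
rewrite probU// => h1.
have h2 : sup S - n.+1%:R^-1 < prob (A n).
  apply: lt_le_trans (proj2 (svalP (ch n))) _.
  apply: le_prob => //; first by apply: mN; case: (svalP (ch n)).
  by rewrite /A big_ord_recr/=; exact: subsetUr.
move: (prob (A n)) (sup S) (prob E) n.+1%:R^-1 ne h1 h2 => a b c x.
by lra.
Qed.

End real_probability.

(** * Finite measurable partitions, as maps to a finite type *)

Definition measurable_partition d (T : measurableType d) (K : finType)
  (q : T -> K) := forall k, measurable (q @^-1` [set k]).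

Lemma measurable_partition_preimage d (T : measurableType d) (K : finType)
  (q : T -> K) (Y : set K) : measurable_partition q -> measurable (q @^-1` Y).
Proof.
move=> mq; rewrite (_ : q @^-1` Y = \bigcup_(k in Y) q @^-1` [set k]).
  by apply: fin_bigcup_measurable.
apply/seteqP; split => [x Yx|x [k Yk /= ->]]//; by exists (q x).
Qed.

Lemma measurable_partition_cst d (T : measurableType d) (K : finType) (k0 : K) :
  measurable_partition (fun _ : T => k0).
Proof.
move=> k; case: (eqVneq k k0) => [->|kk0].
  by rewrite (_ : _ @^-1` _ = setT)//; apply/seteqP; split.
rewrite (_ : _ @^-1` _ = set0)//; apply/seteqP; split => // x /= k0k.
by rewrite k0k eqxx in kk0.
Qed.

Lemma measurable_partition_pair d (T : measurableType d) (K L : finType)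
    (q : T -> K) (r : T -> L) :
  measurable_partition q -> measurable_partition r ->
  measurable_partition (fun x => (q x, r x)).
Proof.
move=> mq mr [k l].
rewrite (_ : _ @^-1` _ = q @^-1` [set k] `&` r @^-1` [set l]).
  exact: measurableI.
by apply/seteqP; split => x /= [-> ->].
Qed.

(** * Splitting, the ultrafilter and independent sequences *)

Section splitting.
Context d (T : measurableType d) (R : realType) (P : probability T R).

Definition splits (U V A : set T) :=
  (0 < P (A `&` U))%E /\ (0 < P (A `&` V))%E.

Definition boundary (K : finType) (q : T -> K) (U V : set T) : set T :=
  [set x | splits U V (q @^-1` [set q x])].

Lemma measurable_boundary (K : finType) (q : T -> K) U V :
  measurable_partition q -> measurable (boundary q U V).
Proof.
move=> mq; exact: (measurable_partition_preimage
  [set k | splits U V (q @^-1` [set k])] mq).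
Qed.

Lemma splitsS U V A B : measurable U -> measurable V -> measurable A ->
  measurable B -> A `<=` B -> splits U V A -> splits U V B.
Proof.
move=> mU mV mA mB AB [AU AV]; split.
- apply: (lt_le_trans AU); rewrite le_measure ?inE//;
    by [exact: measurableI|exact: setSI].
- apply: (lt_le_trans AV); rewrite le_measure ?inE//;
    by [exact: measurableI|exact: setSI].
Qed.

(** A set containing a split set is split, so passing to the common refinement can only shrink the
    boundary. *)
Lemma boundary_pair (K L : finType) (q : T -> K) (r : T -> L) U V :
  measurable_partition q -> measurable_partition r ->
  measurable U -> measurable V ->
  boundary (fun x => (q x, r x)) U V `<=` boundary q U V `&` boundary r U V.
Proof.
move=> mq mr mU mV x h; split; apply: splitsS h => //.
- exact: measurable_partition_pair.
- by move=> y /= [-> _].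
- exact: measurable_partition_pair.
- by move=> y /= [_ ->].
Qed.

Context (I : Type) (U V : I -> set T).
Hypotheses (mU : forall i, measurable (U i)) (mV : forall i, measurable (V i)).
Variable delta : R.
Hypothesis delta0 : 0 < delta.
(** Denies the partition wanted in the end; [I] will be the family [F]. *)
Hypothesis large : forall (K : finType) (q : T -> K), measurable_partition q ->
  exists i, delta <= prob P (boundary q (U i) (V i)).

(** By [large] the index sets are nonempty, and by [boundary_pair] they are directed under common
    refinement; so they generate a proper filter. *)
Lemma boundary_ultrafilter : exists G : set_system I, UltraFilter G /\
  forall (K : finType) (q : T -> K), measurable_partition q ->
    G [set i | delta <= prob P (boundary q (U i) (V i))].
Proof.
pose G0 : set_system I := [set D | exists (K : finType) (q : T -> K),
  measurable_partition q /\
  [set i | delta <= prob P (boundary q (U i) (V i))] `<=` D].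
have PG0 : ProperFilter G0.
  apply: Build_ProperFilter_ex.
    by move=> D [K [q [mq qD]]]; have [i /qD Di] := large mq; exists i.
  split.
  - by exists unit, (fun=> tt); split => //; exact: measurable_partition_cst.
  - move=> D E [K [q [mq qD]]] [L [r [mr rE]]].
    exists (K * L)%type, (fun x => (q x, r x)).
    split; first exact: measurable_partition_pair.
    move=> i /= hi.
    have mqr := measurable_partition_pair mq mr.
    have := boundary_pair mq mr (mU i) (mV i).
    rewrite subsetI => -[hq hr]; have m1 := measurable_boundary (U i) (V i) mqr.
    split; [apply: qD|apply: rE]; apply: (le_trans hi); apply: le_prob => //.
    + exact: measurable_boundary mq.
    + exact: measurable_boundary mr.
  - move=> D E DE [K [q [mq qD]]]; exists K, q; split => //.
    exact: subset_trans DE.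
have [G [UG G0G]] := ultraFilterLemma PG0.
by exists G; split => [//|K q mq]; apply: G0G; exists K, q; split.
Qed.

(** [N] collects the sets in which some partition has, along [G], a null boundary; [B] is the
    complement of an exhausting union of members of [N]. *)
Lemma eventually_split : exists (G : set_system I) (B : set T),
  [/\ UltraFilter G, measurable B, (0 < P B)%E &
   forall A, measurable A -> A `<=` B -> (0 < P A)%E ->
     G [set i | splits (U i) (V i) A]].
Proof.
have [G [UG hG]] := boundary_ultrafilter.
have FG : ProperFilter G by exact: ultra_proper.
pose N : set (set T) := [set A | measurable A /\
  exists (K : finType) (q : T -> K), measurable_partition q /\
  G [set i | prob P (A `&` boundary q (U i) (V i)) = 0]].
have mN A : N A -> measurable A by case.
have mb (K : finType) (q : T -> K) (mq : measurable_partition q) i :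
  measurable (boundary q (U i) (V i)) by exact: measurable_boundary.
have N0 : N set0.
  split => //; exists unit, (fun=> tt); split.
    exact: measurable_partition_cst.
  by apply: filterE => i /=; rewrite set0I prob0.
have NU A B : N A -> N B -> N (A `|` B).
  move=> [mA [K [q [mq hq]]]] [mB [L [r [mr hr]]]].
  split; first exact: measurableU.
  have mqr := measurable_partition_pair mq mr.
  exists (K * L)%type, (fun x => (q x, r x)); split => //.
  apply: filterS (filterI hq hr) => i [/= Aq Br].
  have := boundary_pair mq mr (mU i) (mV i); rewrite subsetI => -[bq br].
  apply/eqP; rewrite eq_le prob_ge0 andbT setIUl.
  have mI (C D : set T) : measurable C -> measurable D -> measurable (C `&` D).
    exact: measurableI.
  have m0 := mb _ _ mqr i; have m1 := mb _ _ mq i; have m2 := mb _ _ mr i.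
  apply: le_trans (le_probU _ (mI _ _ mA m0) (mI _ _ mB m0)) _.
  rewrite -[leRHS](addr0 0) -{1}Aq -Br lerD// le_prob//; try exact: mI.
  - exact: setIS.
  - exact: setIS.
have [A [NA ndA hA]] := exhaustion P mN N0 NU.
have mA n : measurable (A n) by exact/mN/NA.
have mZ : measurable (\bigcup_n A n) by exact: bigcupT_measurable.
exists G, (~` \bigcup_n A n); split => //.
- exact: measurableC.
- rewrite (probE _ (measurableC mZ)) lte_fin probC//.
  (* Along [G] the boundary of [q] has measure at least [delta] but is null inside [A n], so
     [prob P (A n)] is at most [1 - delta]; the whole union exceeds it by less than [delta]. *)
  have [n hn] := prob_bigcup_approx P mA ndA delta0.
  have [_ [K [q [mq hq]]]] := NA n.
  have [i [/= Aq dq]] := filter_ex (filterI hq (hG _ _ mq)).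
  suff : delta <= 1 - prob P (A n) by lra.
  rewrite -probC//; apply: (le_trans dq).
  rewrite -[leRHS]add0r -Aq -[X in prob P X <= _](setIT _) -(setUv (A n)).
  rewrite setIUr.
  have m1 := measurableI _ _ (mA n) (mb _ _ mq i).
  have m2 := measurableI _ _ (mb _ _ mq i) (measurableC (mA n)).
  rewrite (setIC _ (A n)); apply: le_trans (le_probU P m1 m2) _.
  rewrite lerD2l le_prob//; exact: measurableC.
- move=> E mE EA PE.
  (* With [E] as a cell, a boundary that meets [E] means that [E] is split. Were the boundary null
     in [E] along [G], then [E] would belong to [N] and, missing the union, be null. *)
  have mqE : measurable_partition (fun x => `[< E x >]).
    move=> [].
      by rewrite (_ : _ @^-1` _ = E)//; apply/seteqP; split => x /= /asboolP.
    rewrite (_ : _ @^-1` _ = ~` E); first exact: measurableC.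
    by apply/seteqP; split => x /=; [move/asboolP|move/asboolPn/negbTE].
  have [hE|] := in_ultra_setVsetC [set i | prob P (E `&`
     boundary (fun x => `[< E x >]) (U i) (V i)) = 0] UG.
    have NE : N E by split => //; exists bool, (fun x => `[< E x >]).
    have E0 := hA E NE; move: PE; rewrite probE// E0 ?ltxx//.
    by rewrite -subset0 => x [/EA].
  apply: filterS => i /= h.
  have [x [Ex]] : E `&` boundary (fun x => `[< E x >]) (U i) (V i) !=set0.
    by apply/set0P/eqP => e; apply: h; rewrite e prob0.
  rewrite /boundary/= (_ : _ @^-1` _ = E)//.
  by apply/seteqP; split => y /=; rewrite (asboolT Ex) => /asboolP.
Qed.

(** Induction on [n] for all finite lists at once: one [i] splits every set of the list, and the
    traces on [U i] and [V i] form the next list. *)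
Lemma independent_aux (G : set_system I) (B : set T) (n : nat)
    (ps : seq (set T)) : UltraFilter G ->
  (forall A, measurable A -> A `<=` B -> (0 < P A)%E ->
     G [set i | splits (U i) (V i) A]) ->
  (forall A, A \in ps -> [/\ measurable A, A `<=` B & (0 < P A)%E]) ->
  exists j : nat -> I, forall A, A \in ps -> forall s : nat -> bool,
    exists2 x, A x &
      forall k, (k < n)%N -> (if s k then U (j k) else V (j k)) x.
Proof.
move=> UG hB; have FG : ProperFilter G by exact: ultra_proper.
elim: n ps => [|n IH] ps hps.
  have [i _] := filter_ex (filterT (F := G)).
  exists (fun=> i) => A /hps[mA _ PA] s.
  suff [x Ax] : A !=set0 by exists x.
  by apply/set0P/eqP => A0; move: PA; rewrite A0 measure0 ltxx.
have [i hi] : exists i, forall A, A \in ps -> splits (U i) (V i) A.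
  apply: (@filter_ex _ G).
  elim: ps hps => [|A ps IHps] hps; first by apply: filterE => i.
  have [mA AB PA] := hps A (mem_head _ _).
  have := IHps (fun A' h => hps A' (mem_behead (s := A :: ps) h)).
  apply: filterS2 (hB A mA AB PA) => i Ai hi A'.
  by rewrite inE => /predU1P[->//|]; exact: hi.
pose ps' := [seq A `&` U i | A <- ps] ++ [seq A `&` V i | A <- ps].
have [|j hj] := IH ps'.
  move=> A; rewrite mem_cat => /orP[] /mapP[A' A'ps ->].
  - have [mA' A'B _] := hps _ A'ps; have [? _] := hi _ A'ps.
    by split => //; [exact: measurableI|move=> x [/A'B]].
  - have [mA' A'B _] := hps _ A'ps; have [_ ?] := hi _ A'ps.
    by split => //; [exact: measurableI|move=> x [/A'B]].
exists (fun k => if k is k'.+1 then j k' else i) => A Aps s.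
have : A `&` (if s 0%N then U i else V i) \in ps'.
  rewrite mem_cat; case: (s 0%N); apply/orP; [left|right];
  by apply/mapP; exists A.
move=> /hj/(_ (fun k => s k.+1))[x [Ax sx] hx].
by exists x => // -[|k] kn; [case: (s 0%N) sx|exact: hx].
Qed.

Lemma independent_sequence n : exists j : nat -> I, forall s : nat -> bool,
  exists x, forall k, (k < n)%N -> (if s k then U (j k) else V (j k)) x.
Proof.
have [G [B [UG mB PB hB]]] := eventually_split.
have [|j hj] := @independent_aux G B n [:: B] UG hB.
  by move=> A; rewrite inE => /eqP ->; split.
by exists j => s; have [x _ ?] := hj B (mem_head _ _) s; exists x.
Qed.

End splitting.

(** * Level sets and the gap dimension *)

Section level_sets.
Context d (T : measurableType d) (R : realType).

Definition above (f : T -> R) (r : R) : set T := [set x | r < f x].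
Definition below (f : T -> R) (r : R) : set T := [set x | f x < r].

Lemma measurable_above f r : measurable_fun setT f -> measurable (above f r).
Proof.
move=> /(_ measurableT _ (measurable_itv `]r, +oo[)); rewrite setTI.
rewrite (_ : _ @^-1` _ = above f r)//.
by apply/seteqP; split => x; rewrite /above/= in_itv/= andbT.
Qed.

Lemma measurable_below f r : measurable_fun setT f -> measurable (below f r).
Proof.
move=> /(_ measurableT _ (measurable_itv `]-oo, r[)); rewrite setTI.
rewrite (_ : _ @^-1` _ = below f r)//.
Qed.

End level_sets.

Section gap_dimension_partition.
Context (R : realType).

(** Duality: take one function for each of the [2 ^ k] subsets of ['I_k], and let the point [x p]
    realize the pattern that is high exactly on the subsets containing [p]. *)
Lemma gap_dim_independent (T : Type) (F : set (T -> R)) (gamma alpha : R) :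
  0 < gamma ->
  (forall n, exists j : nat -> T -> R, (forall k, F (j k)) /\
     forall s : nat -> bool, exists x, forall k, (k < n)%N ->
       if s k then alpha + gamma < j k x else j k x < alpha - gamma) ->
  gap_dim gamma F = +oo%E.
Proof.
move=> g0 indep; apply: eq_infty => r.
have [k rk] : exists k : nat, r <= k%:R.
  exists (Num.bound `|r|).
  by rewrite (le_trans (ler_norm r))// ltW// archi_boundP.
rewrite -lee_fin in rk; apply: (le_trans rk); apply: ereal_sup_ubound.
exists k => //=.
have [j [Fj hj]] := indep #|{set 'I_k}|.
(* [c] is decoded as a subset; indices beyond the number of subsets get [false] and are never
   consulted. *)
pose s (p : 'I_k) (c : nat) :=
  if insub c is Some o then p \in enum_val (o : 'I_#|{set 'I_k}|) else false.
have [x hx] := choice (fun p => hj (s p)).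
have hS (S : {set 'I_k}) p :
    if p \in S then alpha + gamma < j (enum_rank S) (x p)
    else j (enum_rank S) (x p) < alpha - gamma.
  have := hx p (enum_rank S) (ltn_ord _).
  by rewrite /s valK enum_rankK.
exists (range x).
  (* The function of the singleton of [p] is high at [x p] and low at every other [x p']. *)
  have xinj : {in [set: 'I_k] &, injective x}.
    move=> p p' _ _ e; apply/eqP; apply: contraT => pp'.
    have := hS [set p]%SET p; have := hS [set p]%SET p'.
    rewrite !inE eqxx eq_sym (negbTE pp') e; lra.
  apply: card_eq_trans (inj_card_eq xinj) _.
  by rewrite card_eq_sym; exact: card_II.
exists alpha => D0 D0x.
exists (j (enum_rank [set p | `[< D0 (x p) >]]%SET)) => //; split => y.
- move=> D0y; have [p _ py] := D0x _ D0y.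
  have := hS [set p | `[< D0 (x p) >]]%SET p; rewrite inE py.
  by rewrite asboolT.
- move=> [[p _ <-] D0y].
  have := hS [set p | `[< D0 (x p) >]]%SET p; rewrite inE.
  by rewrite asboolF.
Qed.

Lemma gap_dim_partition d (T : measurableType d) (P : probability T R)
    (F : set (T -> R)) (gamma alpha delta : R) :
  (forall f, F f -> measurable_fun setT f) ->
  0 < gamma -> (gap_dim gamma F < +oo)%E -> 0 < delta ->
  exists (K : finType) (q : T -> K), measurable_partition q /\
    forall f, F f -> prob P (boundary P q (above f (alpha + gamma))
                                          (below f (alpha - gamma))) < delta.
Proof.
move=> mF g0 gF d0; apply: contrapT => noq.
pose U (i : {f | F f}) := above (sval i) (alpha + gamma).
pose V (i : {f | F f}) := below (sval i) (alpha - gamma).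
have mU i : measurable (U i) by apply: measurable_above; exact/mF/svalP.
have mV i : measurable (V i) by apply: measurable_below; exact/mF/svalP.
have large (K : finType) (q : T -> K) : measurable_partition q ->
    exists i, delta <= prob P (boundary P q (U i) (V i)).
  move=> mq; apply: contrapT => noi; apply: noq; exists K, q; split => // f Ff.
  rewrite ltNge; apply/negP => h; apply: noi; by exists (exist _ f Ff).
suff : gap_dim gamma F = +oo%E by move=> e; rewrite e in gF.
apply: (gap_dim_independent (alpha := alpha) g0) => n.
have [j hj] := independent_sequence mU mV d0 large n.
exists (fun k => sval (j k)); split => [k|s]; first exact: svalP.
have [x hx] := hj s; exists x => k kn; have := hx k kn.
by case: (s k).
Qed.

End gap_dimension_partition.

(** * Expectations and finite sums of indicators *)

Lemma indic_ge0 (R : realType) (T : Type) (A : set T) x : 0 <= \1_A x :> R.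
Proof. by rewrite indicE ler0n. Qed.

Lemma indic_le1 (R : realType) (T : Type) (A : set T) x : \1_A x <= 1 :> R.
Proof. by rewrite indicE lern1 leq_b1. Qed.

Lemma bounded_integrable d (T : measurableType d) (R : realType)
    (P : probability T R) (f : T -> R) (M : R) :
  measurable_fun setT f -> (forall x, `|f x| <= M) ->
  P.-integrable setT (EFin \o f).
Proof.
move=> mf fM; apply: measurable_bounded_integrable => //.
  by rewrite (_ : _ setT = 1%E) ?ltry//; exact: probability_setT.
exists M; split; first exact: num_real.
by move=> y /ltW My x _; exact: le_trans (fM x) My.
Qed.

Lemma fine_expectationN d (T : measurableType d) (R : realType)
    (P : probability T R) (f : T -> R) (M : R) :
  measurable_fun setT f -> (forall x, `|f x| <= M) ->
  fine ('E_P[\- f])%E = - fine ('E_P[f])%E.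
Proof.
move=> mf fM.
have fL : f \in Lfun P 1.
  by apply/Lfun1_integrable; exact: bounded_integrable fM.
have -> : \- f = -1 \o* f by apply/funext => x /=; rewrite mulrN1.
by rewrite expectationZl// fineM ?expectation_fin_num//= mulN1r.
Qed.

(** Together with [sum_indic_ge], this reduces later estimates of means and probabilities to
    pointwise inequalities between finite sums. *)
Lemma expectation_le_indic d (T : measurableType d) (R : realType)
    (P : probability T R) (I : finType) (A : I -> set T) (c : I -> R)
    (f : T -> R) (M : R) :
  (forall i, measurable (A i)) -> measurable_fun setT f ->
  (forall x, `|f x| <= M) -> (forall x, f x <= \sum_i c i * \1_(A i) x) ->
  fine ('E_P[f])%E <= \sum_i c i * prob P (A i).
Proof.
move=> mA mf fM fA.
have mg i : measurable_fun setT (fun x => c i * \1_(A i) x).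
  by apply: measurable_funM => //; exact: measurable_indic.
have ig i : P.-integrable setT (EFin \o (fun x => c i * \1_(A i) x)).
  apply: (@bounded_integrable _ _ _ _ _ `|c i|) => // x.
  by rewrite normrM indicE ler_piMr// normr_nat lern1 leq_b1.
have iS : P.-integrable setT (EFin \o (fun x => \sum_i c i * \1_(A i) x)).
  rewrite (_ : _ \o _ = fun x => \sum_i (c i * \1_(A i) x)%:E)%E; last first.
    by apply/funext => x /=; rewrite sumEFin.
  exact: (integrable_sum measurableT _ (fun i _ => ig i)).
rewrite unlock.
apply: (@le_trans _ _ (fine (\int[P]_x (\sum_i c i * \1_(A i) x)%:E))).
  by apply: le_Rintegral => //; exact: bounded_integrable mf fM.
under eq_integral do rewrite -sumEFin.
rewrite (integral_sum measurableT ig).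
rewrite (eq_bigr (fun i => (c i * prob P (A i))%:E)) ?sumEFin// => i _.
under eq_integral do rewrite /= EFinM.
rewrite (@integralZl _ _ _ P _ measurableT (EFin \o \1_(A i))); last first.
  apply: (@bounded_integrable _ _ _ _ _ 1); first exact: measurable_indic.
  by move=> x; rewrite indicE normr_nat lern1 leq_b1.
by rewrite integral_indic// setIT EFinM -probE.
Qed.

Lemma sum_indic_ge d (T : measurableType d) (R : realType)
    (P : probability T R) (I : finType) (A : I -> set T) (c : I -> R) (r : R) :
  (forall i, measurable (A i)) -> (forall x, r <= \sum_i c i * \1_(A i) x) ->
  r <= \sum_i c i * prob P (A i).
Proof.
move=> mA rA; rewrite -[leLHS]/(fine r%:E) -(expectation_cst P r).
exact: (@expectation_le_indic _ _ _ P _ A c (cst r) `|r|).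
Qed.

(** * Visit counts along a path *)

Lemma iter_shift dT (T : measurableType dT) m (u : nat -> T) i :
  iter m (@Defs.shift _ T) u i = u (m + i)%N.
Proof. by elim: m i => //= m IHm i; rewrite /Defs.shift IHm addnS. Qed.

Section visits.
Context dT (T : measurableType dT) (R : realType).

Definition visits (B : set T) (n : nat) (u : nat -> T) : R :=
  \sum_(i < n) \1_B (u i).

Lemma visits_le B n u : visits B n u <= n%:R.
Proof.
rewrite -[leRHS]mulr_natl mulr1 -[n in leRHS]card_ord -sumr_const.
by apply: ler_sum => i _; exact: indic_le1.
Qed.

Lemma visitsS B n u :
  visits B n.+1 u = \1_B (u 0%N) + visits B n (Defs.shift u).
Proof. by rewrite /visits big_ord_recl. Qed.

Lemma visitsC B n u : visits (~` B) n u = n%:R - visits B n u.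
Proof.
apply/eqP; rewrite eq_sym subr_eq -big_split/=; apply/eqP.
rewrite (eq_bigr (fun=> 1)) ?sumr_const ?card_ord// => i _.
by rewrite !indicE in_setC; case: (_ \in B); rewrite ?addr0 ?add0r.
Qed.

(** The event that [visits B n u - n * t] is unbounded above in [n]; off it, [n * t] plus a constant
    bounds all visit counts. *)
Definition unbounded_excess (B : set T) (t : R) : set (nat -> T) :=
  \bigcap_(k in [set: nat]) \bigcup_n [set u | n%:R * t + k%:R < visits B n u].

(** One shift changes the excess by at most [1 + |t|], which a larger [k] absorbs. *)
Lemma unbounded_excess_shift B t :
  Defs.shift @^-1` unbounded_excess B t = unbounded_excess B t.
Proof.
apply/seteqP; split => u hu k _.
- have [n _ /= hn] := hu (k + Num.bound `|t|)%N I.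
  exists n.+1 => //=; rewrite visitsS.
  have tb : t < (Num.bound `|t|)%:R.
    exact: le_lt_trans (ler_norm t) (archi_boundP _).
  move: hn (indic_ge0 R B (u 0%N)); rewrite natrD -natr1 mulrDl mul1r.
  move: (n%:R * t) tb => *; lra.
- have [[|n] _ /= hn] := hu (k.+1 + Num.bound `|t|)%N I.
    move: hn; rewrite mul0r add0r /visits big_ord0 => hn.
    by exfalso; move: hn; rewrite ltNge ler0n.
  exists n => //=; move: hn; rewrite visitsS.
  have tb : - t < (Num.bound `|t|)%:R.
    by apply: le_lt_trans (archi_boundP _) => //; rewrite -normrN ler_norm.
  have := indic_le1 R B (u 0%N).
  rewrite natrD -(natr1 k) -(natr1 n) mulrDl mul1r.
  move: (n%:R * t) tb => *; lra.
Qed.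

(* Cut the path into stretches of length at most N along which B is visited with
   frequency more than t, single points of D, and a remainder shorter than N. *)
Lemma covering_bound (B : set T) (D : set (nat -> T)) (t : R) (N : nat) :
  0 <= t <= 1 ->
  (forall u, ~ D u -> exists n, (0 < n <= N)%N /\ n%:R * t < visits B n u) ->
  forall L (u : nat -> T), (L%:R - N%:R) * t <=
    \sum_(i < L) (\1_B (u i) + \1_D (iter i (@Defs.shift _ T) u)).
Proof.
move=> /andP[t0 t1] hD L; elim/ltn_ind: L => L IH u.
have pos m (v : nat -> T) :
    0 <= \sum_(i < m) (\1_B (v i) + \1_D (iter i (@Defs.shift _ T) v)) :> R.
  by apply: sumr_ge0 => i _; rewrite addr_ge0// indic_ge0.
have [LN|NL] := leqP L N.
  apply: le_trans (pos _ _); rewrite mulr_le0_ge0// subr_le0 ler_nat//.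
(* A point of [D] contributes at least 1, hence at least [t]; elsewhere a stretch of length [n]
   contributes more than [n * t]. Induction handles the rest of the path. *)
have [Du|/hD[n [/andP[n0 nN] hn]]] := pselect (D u).
  case: L IH NL => // L IH NL.
  have D1 : \1_D u = 1 :> R by rewrite indicE mem_set.
  rewrite big_ord_recl/= D1.
  rewrite (eq_bigr (fun i : 'I_L => \1_B (Defs.shift u i) +
      \1_D (iter i (@Defs.shift _ T) (Defs.shift u)))); last first.
    by move=> i _; rewrite -iterSr.
  have := IH L (ltnSn _) (Defs.shift u); have := indic_ge0 R B (u 0%N).
  rewrite -natr1 !mulrBl mulrDl mul1r.
  move: (\sum_(i < L) _) (L%:R * t) (N%:R * t) (\1_B (u 0%N)) => s a b c.
  lra.
have [k Lnk] : exists k, L = (n + k)%N.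
  by exists (L - n)%N; rewrite subnKC// (leq_trans nN)// ltnW.
have kL : (k < L)%N by rewrite Lnk -[X in (X < _)%N]add0n ltn_add2r.
have h := IH _ kL (iter n (@Defs.shift _ T) u).
have h1 : visits B n u <=
    \sum_(i < n) (\1_B (u i) + \1_D (iter i (@Defs.shift _ T) u)).
  by apply: ler_sum => i _; rewrite lerDl indic_ge0.
rewrite {L IH NL kL}Lnk big_split_ord/=.
rewrite [X in _ <= _ + X](eq_bigr (fun i : 'I_k =>
    \1_B (iter n (@Defs.shift _ T) u i) +
    \1_D (iter i (@Defs.shift _ T) (iter n (@Defs.shift _ T) u)))); last first.
  by move=> i _; rewrite iter_shift -iterD addnC.
move: hn h1 h; rewrite natrD !mulrBl mulrDl.
move: (visits _ _ _) (n%:R * t) (k%:R * t) (N%:R * t) => a b c e.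
set x := \sum_(i < n) _; set y := \sum_(i < k) _; lra.
Qed.

End visits.

(** * Almost sure frequencies for a stationary ergodic process *)

Lemma measurable_RV_preimage d dT (Omega : measurableType d)
    (T : measurableType dT) (R : realType) (P : probability Omega R)
    (Y : {RV P >-> T}) (A : set T) : measurable A -> measurable (Y @^-1` A).
Proof.
by move=> mA; rewrite -[X in measurable X]setTI; exact: (measurable_funPT Y).
Qed.

Section ergodic_frequencies.
Context d dT (Omega : measurableType d) (T : measurableType dT)
  (R : realType) (P : probability Omega R) (X : nat -> {RV P >-> T}).

(** The generators of [path_measurable], named so that [path] below is a measurable type with that
    sigma-algebra. *)
Definition cylinders : set_system (nat -> T) :=
  [set A | exists i : nat, exists2 B : set T,
    measurable B & A = [set u | B (u i)]].

Let path := g_sigma_algebraType cylinders.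

Let measurable_coord B i : measurable B ->
  measurable ([set u | B (u i)] : set path).
Proof. by move=> mB; apply: sub_sigma_algebra; exists i, B. Qed.

Let measurable_coord_fun i :
  measurable_fun [set: path] (fun u : path => u i : T).
Proof. by move=> _ B mB; rewrite setTI; exact: measurable_coord. Qed.

Let measurable_sample_path :
  measurable_fun setT (sample_path X : Omega -> path).
Proof.
apply: (@measurability _ _ Omega path _ _ cylinders) => //.
move=> _ [_ [i [B mB ->]] <-].
exact: (measurable_funPT (X i)).
Qed.

Let measurable_shift : measurable_fun setT (@Defs.shift _ T : path -> path).
Proof.
apply: (@measurability _ _ path path _ _ cylinders) => //.
move=> _ [_ [i [B mB ->]] <-].
by rewrite setTI; exact: (measurable_coord i.+1).
Qed.

Let measurable_visits B n : measurable B ->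
  measurable_fun setT (visits R B n : path -> R).
Proof.
move=> mB; apply: measurable_sum => i.
apply: measurableT_comp (measurable_coord_fun i).
exact: measurable_indic.
Qed.

Let measurable_gt_visits B n (c : R) : measurable B ->
  measurable ([set u | c < visits R B n u] : set path).
Proof.
move=> mB.
have := measurable_visits n mB measurableT (measurable_itv `]c, +oo[).
rewrite setTI (_ : _ @^-1` _ = [set u | c < visits R B n u])//.
by apply/seteqP; split => u; rewrite /= in_itv/= andbT.
Qed.

Let measurable_unbounded_excess B (t : R) : measurable B ->
  measurable (unbounded_excess B t : set path).
Proof.
move=> mB; apply: bigcapT_measurable => k; apply: bigcupT_measurable => n.
exact: measurable_gt_visits.
Qed.

Let measurable_preimage (A : set path) : measurable A ->
  measurable (sample_path X @^-1` A).
Proof.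
by move=> mA; rewrite -[X in measurable X]setTI; exact: measurable_sample_path.
Qed.

Let measurable_iter_shift (A : set path) i : measurable A ->
  measurable (iter i (@Defs.shift _ T) @^-1` A : set path).
Proof.
move=> mA; elim: i => [//|i IH].
have := measurable_shift measurableT IH; rewrite setTI.
rewrite -comp_preimage (_ : _ \o _ = iter i.+1 (@Defs.shift _ T))//.
by apply/funext => u; rewrite iterSr.
Qed.

Hypothesis stX : stationary X.

Let stationary_iter (A : set path) i : measurable A ->
  prob P (sample_path X @^-1` (iter i (@Defs.shift _ T) @^-1` A)) =
  prob P (sample_path X @^-1` A).
Proof.
move=> mA; elim: i => [//|i IH]; rewrite -IH.
have := stX (measurable_iter_shift i mA).
have -> : Defs.shift @^-1` (iter i (@Defs.shift _ T) @^-1` A) =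
    iter i.+1 (@Defs.shift _ T) @^-1` A.
  by apply/seteqP; split => u /=; rewrite -iterSr.
by rewrite /prob => ->.
Qed.

Lemma stationary_marginal B i : measurable B ->
  prob P (X i @^-1` B) = prob P (X 0%N @^-1` B).
Proof.
move=> mB; rewrite -(stationary_iter i (measurable_coord 0 mB)).
congr (prob P _); apply/funext => w /=; congr (B _).
by rewrite iter_shift addn0.
Qed.

Hypothesis ergX : ergodic X.

(** The event is shift invariant, so it has probability 0 or 1. If 1, most paths begin with a
    stretch of bounded length visiting [B] with frequency above [t]; integrating [covering_bound]
    then contradicts [p < t]. *)
Lemma unbounded_excess_null B t : measurable B -> prob P (X 0%N @^-1` B) < t ->
  P (sample_path X @^-1` unbounded_excess B t) = 0%E.
Proof.
move=> mB pt; have mE := measurable_unbounded_excess t mB.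
have [//|PE] := ergX mE (unbounded_excess_shift B t).
exfalso; set p := prob P _ in pt.
have p0 : 0 <= p by exact: prob_ge0.
have t01 : 0 <= t <= 1.
  rewrite (ltW (le_lt_trans p0 pt))/=.
  have [w] : sample_path X @^-1` unbounded_excess B t !=set0.
    by apply/set0P/eqP => e; move: PE; rewrite e measure0 => /eqP;
      rewrite eqe eq_sym oner_eq0.
  move=> /(_ 0%N I)[[|n] _ /=].
    by rewrite /visits big_ord0 mul0r addr0 ltxx.
  rewrite addr0 => /lt_le_trans/(_ (visits_le _ _ _ _)).
  by rewrite -[ltRHS]mulr1 ltr_pM2l ?ltr0n// => /ltW.
(* Paths that begin with such a stretch of length at most [N]; the union over [N] contains the
   event. *)
pose G N : set path := \bigcup_(n in [set n | (0 < n <= N)%N])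
  [set u | n%:R * t < visits R B n u].
have mG N : measurable (G N).
  by apply: bigcup_measurable => n _; exact: measurable_gt_visits.
pose e := (t - p) / 2.
have e0 : 0 < e by rewrite divr_gt0// subr_gt0.
have [N hN] : exists N, 1 - e < prob P (sample_path X @^-1` G N).
  have ndG : nondecreasing_seq (fun N => sample_path X @^-1` G N).
    move=> m n mn; apply/subsetPset => w [k /= /andP[k0 km] h].
    by exists k => //=; rewrite k0 (leq_trans km mn).
  have [N hN] :=
    prob_bigcup_approx P (fun N => measurable_preimage (mG N)) ndG e0.
  exists N; apply: le_lt_trans hN; rewrite lerB//.
  have -> : 1 = prob P (sample_path X @^-1` unbounded_excess B t).
    by rewrite /prob PE.
  apply: le_prob; [exact: measurable_preimage| |].
    by apply: bigcupT_measurable => n; exact: measurable_preimage.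
  move=> w /(_ 0%N I)[[|n] _ /=].
    by rewrite /visits big_ord0 mul0r addr0 ltxx.
  by rewrite addr0 => h; exists n.+1 => //; exists n.+1 => //=; rewrite leqnn.
have mD : measurable (~` G N) by exact: measurableC.
have PD : prob P (sample_path X @^-1` (~` G N)) < e.
  rewrite preimage_setC probC; first by move: hN; lra.
  exact: (measurable_preimage (mG N)).
(* By stationarity each of the [L] steps contributes [p] for [B] and less than [e] for the
   exceptional set. *)
have bound L : (L%:R - N%:R) * t <= L%:R * (p + e).
  pose A (i : 'I_L + 'I_L) := match i with
    | inl i => X i @^-1` B
    | inr i => sample_path X @^-1` (iter i (@Defs.shift _ T) @^-1` (~` G N))
    end.
  have mA i : measurable (A i).
    case: i => i /=; first exact: measurable_RV_preimage.
    by apply: measurable_preimage; exact: measurable_iter_shift.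
  have : (L%:R - N%:R) * t <= \sum_i 1 * prob P (A i).
    apply: sum_indic_ge => // w; under eq_bigr do rewrite mul1r.
    rewrite big_sumType/= -big_split/=.
    apply: (covering_bound (B := B) (D := ~` G N) t01) => u.
    by move=> /contrapT[n /= n0 hn]; exists n.
  under eq_bigr do rewrite mul1r.
  rewrite big_sumType/= => /le_trans; apply.
  rewrite mulrDr; apply: lerD.
  - rewrite (eq_bigr (fun=> p)) ?sumr_const ?card_ord ?mulr_natl// => i _.
    exact: stationary_marginal.
  - rewrite -[L in leRHS]card_ord mulr_natl -sumr_const ler_sum// => i _.
    by rewrite stationary_iter// ltW.
(* As [t = p + 2 * e], the bound says [L * e <= N * t], which this [L] violates. *)
have := bound (Num.bound (N%:R * t / e)).
have : N%:R * t / e < (Num.bound (N%:R * t / e))%:R.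
  have [t0 _] := andP t01; apply: archi_boundP.
  by apply: divr_ge0 (ltW e0); exact: mulr_ge0.
rewrite ltr_pdivrMr//; move: (Num.bound _) => L.
have -> : t = p + e + e by rewrite /e; lra.
rewrite mulrBl [L%:R * (p + e + e)]mulrDr.
move: (L%:R * (p + e)) (N%:R * _) (L%:R * e) => a b c; lra.
Qed.

Lemma ae_visits_le B t : measurable B -> prob P (X 0%N @^-1` B) < t ->
  {ae P, forall w, exists k : nat, forall n,
    visits R B n (sample_path X w) <= n%:R * t + k%:R}.
Proof.
move=> mB pt; exists (sample_path X @^-1` unbounded_excess B t); split.
- by apply: measurable_preimage; exact: measurable_unbounded_excess.
- exact: unbounded_excess_null.
- move=> w /= h k _; apply: contrapT => nh; apply: h; exists k => n.
  by rewrite leNgt; apply/negP => h; apply: nh; exists n.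
Qed.

(** Lower deviations come from [ae_visits_le] for the complement of [B]. This is the ergodic theorem
    for an indicator, to precision [e]. *)
Lemma ae_visits B e : measurable B -> 0 < e ->
  {ae P, forall w, exists k : nat, forall n,
    `|visits R B n (sample_path X w) - n%:R * prob P (X 0%N @^-1` B)|
      <= n%:R * e + k%:R}.
Proof.
move=> mB e0; set p := prob P _.
have mX : measurable (X 0%N @^-1` B) by exact: measurable_RV_preimage.
have h1 : p < p + e by rewrite ltrDl.
have h2 : prob P (X 0%N @^-1` (~` B)) < 1 - p + e.
  by rewrite preimage_setC probC// -/p ltrDl.
apply: filterS2 (ae_visits_le mB h1) (ae_visits_le (measurableC mB) h2).
move=> w [k hk] [l hl]; exists (k + l)%N => n.
have := hk n; have := hl n; rewrite visitsC ler_norml natrD !mulrDr mulrN mulr1.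
have : 0 <= k%:R :> R by []; have : 0 <= l%:R :> R by [].
move: (visits _ _ _ _) (n%:R * p) (n%:R * e) => a b c *; apply/andP; split; lra.
Qed.

End ergodic_frequencies.

(** * A partition that serves all of [F] *)

Lemma grid_gap (R : realType) (M gamma a b : R) (J : nat) :
  0 < gamma -> M < gamma * J%:R -> - M <= a -> b <= M -> 4 * gamma < b - a ->
  exists2 j, (j < J)%N &
    a < - M + 2 * gamma * j%:R - gamma /\ - M + 2 * gamma * j%:R + gamma < b.
Proof.
move=> g0 MJ Ma bM ab.
have g2 : 0 < 2 * gamma by rewrite mulr_gt0.
have aMg : 0 <= (a + M + gamma) / (2 * gamma) by rewrite divr_ge0 ?ltW//; lra.
have ex : exists n : nat, a + M + gamma < 2 * gamma * n%:R.
  have := archi_boundP aMg; rewrite ltr_pdivrMr// mulrC => h.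
  by exists (Num.bound ((a + M + gamma) / (2 * gamma))).
(* The least grid level above [a + gamma] is at most [a + 3 * gamma], hence below [b - gamma]; being
   less than [M], it has index below [J]. *)
case: (ex_minnP ex) => -[|n] hn nmin.
  by move: hn; rewrite mulr0; lra.
have h : 2 * gamma * n%:R <= a + M + gamma.
  by rewrite leNgt; apply/negP => /nmin; rewrite ltnn.
have e : 2 * gamma * n.+1%:R = 2 * gamma * n%:R + 2 * gamma.
  by rewrite -(natr1 n) mulrDr mulr1.
rewrite e in hn.
exists n.+1; last by rewrite e; split; lra.
rewrite -(ltr_nat R) -(ltr_pM2l g2) e.
have eJ : 2 * gamma * J%:R = 2 * (gamma * J%:R) by rewrite mulrA.
rewrite eJ; move: (gamma * J%:R) (2 * gamma * n%:R) MJ h hn => *; lra.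
Qed.

Section uniform_partition.
Context d (T : measurableType d) (R : realType) (P : probability T R).

(** A finite union of null sets. Once it is removed, each remaining point of [U] shows that its cell
    meets [U] in positive measure. *)
Lemma null_cells (K : finType) (q : T -> K) (U : set T) :
  measurable_partition q -> measurable U ->
  P ([set x | P (q @^-1` [set q x] `&` U) = 0%E] `&` U) = 0%E.
Proof.
move=> mq mU; pose Z := [set k | P (q @^-1` [set k] `&` U) = 0%E].
rewrite (_ : _ `&` U = \bigcup_(k in Z) (q @^-1` [set k] `&` U)).
  rewrite measure_fin_bigcup ?fsbig1//.
  - exact: finite_finset.
  - by move=> k l _ _ [x [[/= <- _] [<- _]]].
  - by move=> k _; exact: measurableI.
apply/seteqP; split => [x [Px Ux]|x [k Zk [/= qx Ux]]].
  by exists (q x).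
by split => //=; rewrite qx.
Qed.

Context (F : set (T -> R)) (M gamma : R).
Hypotheses (mF : forall f, F f -> measurable_fun setT f)
  (FM : forall f, F f -> forall x, `|f x| <= M)
  (g0 : 0 < gamma) (gF : (gap_dim gamma F < +oo)%E).

Let level (j : nat) : R := - M + 2 * gamma * j%:R.

Let cells_split (K : finType) (q : T -> K) f J : set K :=
  [set k | exists2 j, (j < J)%N & splits P (above f (level j + gamma))
     (below f (level j - gamma)) (q @^-1` [set k])].

(** Refine level by level: refining never enlarges the part split at earlier levels, so each level
    adds at most [delta]. *)
Let small_boundaries J (delta : R) : 0 < delta ->
  exists (K : finType) (q : T -> K), measurable_partition q /\
    forall f, F f -> prob P (q @^-1` cells_split q f J) <= J%:R * delta.
Proof.
move=> d0; elim: J => [|J [K [q [mq hq]]]].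
  exists unit, (fun=> tt); split; first exact: measurable_partition_cst.
  move=> f _; rewrite mul0r (_ : _ @^-1` _ = set0) ?prob0//.
  by rewrite -subset0 => x [].
have [L [r [mr hr]]] := gap_dim_partition P (level J) mF g0 gF d0.
have mqr := measurable_partition_pair mq mr.
exists (K * L)%type, (fun x => (q x, r x)); split => // f Ff.
have mA a := measurable_above a (mF Ff).
have mB b := measurable_below b (mF Ff).
rewrite -natr1 mulrDl mul1r.
apply: le_trans (lerD (hq f Ff) (ltW (hr f Ff))).
apply: le_trans (le_probU P _ _).
- apply: le_prob; [exact: measurable_partition_preimage| |].
    apply: measurableU; first exact: measurable_partition_preimage.
    exact: measurable_boundary.
  move=> x [j]; rewrite ltnS leq_eqVlt => /predU1P[->|jJ] h.
    by right; apply: (boundary_pair mq mr (mA _) (mB _) h).2.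
  by left; exists j => //; apply: (boundary_pair mq mr (mA _) (mB _) h).1.
- exact: measurable_partition_preimage.
- exact: measurable_boundary.
Qed.

(** [Y] marks the cells split at some grid level, and [N] collects the null traces of level sets on
    cells. An oscillation above [4 * gamma] off [N] contains a grid level with its gap by
    [grid_gap], so the cell is split there. *)
Lemma uniform_partition (delta : R) : 0 < delta ->
  exists (K : finType) (q : T -> K), measurable_partition q /\
    forall f, F f -> exists (Y : pred K) (c : K -> R) (N : set T),
      [/\ measurable N, P N = 0%E, prob P [set x | Y (q x)] <= delta,
        forall k, `|c k| <= M &
        forall x, ~ N x ->
          `|f x - c (q x)| <= 4 * gamma + (Y (q x))%:R * (2 * M)].
Proof.
(* Enough levels to cover the range from [- M] to [M]; each gets the share [delta / J]. *)
move=> d0; pose J := (Num.bound (`|M| / gamma)).+1.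
have MJ : M < gamma * J%:R.
  rewrite mulrC -ltr_pdivrMr//; apply: le_lt_trans (_ : `|M| / gamma < _).
    by rewrite ler_pM2r ?invr_gt0// ler_norm.
  rewrite (lt_trans (archi_boundP _)) ?divr_ge0 ?(ltW g0)//.
  by rewrite ltr_nat.
have J0 : 0 < J%:R :> R by [].
have [K [q [mq hq]]] := small_boundaries J (divr_gt0 d0 J0).
exists K, q; split => // f Ff.
have mA a := measurable_above a (mF Ff).
have mB b := measurable_below b (mF Ff).
pose nul (U : set T) : set T :=
  [set x | P (q @^-1` [set q x] `&` U) = 0%E] `&` U.
have mnul U : measurable U -> measurable (nul U).
  move=> mU; apply: measurableI => //.
  exact: (measurable_partition_preimage
    [set k | P (q @^-1` [set k] `&` U) = 0%E] mq).
pose Nj j :=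
  nul (above f (level j + gamma)) `|` nul (below f (level j - gamma)).
pose N := \bigcup_j Nj j.
have mN : measurable N.
  by apply: bigcupT_measurable => j; apply: measurableU; exact: mnul.
(* For a cell contained in [N], [get] returns a default point, which still gives [|c k| <= M]. *)
pose c k := f (get (q @^-1` [set k] `\` N)).
exists (fun k => `[< cells_split q f J k >]), c, N; split => //.
- apply/negligibleP => //; apply: negligible_bigcup => j.
  by apply: negligibleU; apply/negligibleP; [exact: mnul|exact: null_cells
    |exact: mnul|exact: null_cells].
- rewrite (_ : [set x | _] = q @^-1` cells_split q f J); last first.
    by apply/seteqP; split => x /= /asboolP.
  by apply: le_trans (hq f Ff) _; rewrite mulrC divfK// gt_eqF.
- by move=> k; exact: FM.
move=> x Nx; rewrite /c.
have [] : (q @^-1` [set q x] `\` N) (get (q @^-1` [set q x] `\` N)).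
  by apply: getPex; exists x.
move: (get _) => y /= qy Ny.
have fM z : - M <= f z <= M by rewrite -ler_norml; exact: FM.
case: asboolP => [_|nsplit].
  rewrite mul1r ler_norml; move: (fM x) (fM y) g0.
  move: (f x) (f y) => a b /andP[? ?] /andP[? ?] ?.
  by apply/andP; split; lra.
rewrite mul0r addr0.
have osc z z' : q z = q x -> q z' = q x -> ~ N z -> ~ N z' ->
    f z - f z' <= 4 * gamma.
  move=> qz qz' Nz Nz'; rewrite leNgt; apply/negP => gap.
  have /andP[Mz' _] := fM z'; have /andP[_ zM] := fM z.
  have [j jJ [z'j zj]] := grid_gap g0 MJ Mz' zM gap.
  apply: nsplit; exists j => //; split.
    rewrite measure_gt0; apply/eqP => P0; apply: Nz; exists j => //; left.
    by split => //=; rewrite qz.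
  rewrite measure_gt0; apply/eqP => P0; apply: Nz'; exists j => //; right.
  by split => //=; rewrite qz'.
by rewrite ler_norml lerNl opprB !osc.
Qed.

End uniform_partition.

(** * Averages and means of functions nearly constant on cells *)

Section averages.
Context dT (T : measurableType dT) (R : realType) (K : finType) (q : T -> K).
Hypothesis mq : measurable_partition q.

Lemma sum_indic_cells (c : K -> R) (k : K) :
  \sum_l c l * (l == k)%:R = c k.
Proof.
rewrite (bigD1 k)//= eqxx mulr1 big1 ?addr0// => l /negbTE ->.
by rewrite mulr0.
Qed.

Lemma indic_cell k x : \1_(q @^-1` [set k]) x = (k == q x)%:R :> R.
Proof.
rewrite indicE; congr (nat_of_bool _)%:R.
by apply/idP/eqP => [/set_mem/= ->//|->]; rewrite inE.
Qed.

Lemma average_visits (c : K -> R) m (u : nat -> T) :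
  m%:R^-1 * \sum_(i < m) c (q (u i)) =
  \sum_k c k * (m%:R^-1 * visits R (q @^-1` [set k]) m u).
Proof.
under [RHS]eq_bigr do rewrite mulrCA mulr_sumr.
rewrite -mulr_sumr exchange_big/=; congr (_ * _); apply: eq_bigr => i _.
by under eq_bigr do rewrite indic_cell; rewrite sum_indic_cells.
Qed.

Context d (Omega : measurableType d) (P : probability Omega R)
  (X : nat -> {RV P >-> T}).

Local Notation p k := (prob P (X 0%N @^-1` (q @^-1` [set k]))).

(** On [N] the bound may fail, so the indicator of [N] enters with a dominating coefficient, at no
    cost in probability. *)
Lemma mean_le (f : T -> R) (M : R) (u : K -> R) (N : set T) :
  measurable_fun setT f -> (forall x, `|f x| <= M) ->
  measurable N -> P (X 0%N @^-1` N) = 0%E ->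
  (forall x, ~ N x -> f x <= u (q x)) ->
  fine ('E_P[f \o X 0%N])%E <= \sum_k u k * p k.
Proof.
move=> mf fM mN PN fu.
pose A (o : 'I_1 + K) := if o is inr k then X 0%N @^-1` (q @^-1` [set k])
  else X 0%N @^-1` N.
pose c (o : 'I_1 + K) := if o is inr k then u k else M + \sum_k `|u k|.
have mA o : measurable (A o) by case: o => [i|k]; exact: measurable_RV_preimage.
have -> : \sum_k u k * p k = \sum_o c o * prob P (A o).
  by rewrite big_sumType big_ord1/= /prob PN mulr0 add0r.
apply: (@expectation_le_indic _ _ _ P _ A c (f \o X 0%N) M) => //.
- exact: measurableT_comp.
- by move=> w; exact: fM.
move=> w; rewrite big_sumType big_ord1/=.
have -> : \sum_k u k * \1_(X 0%N @^-1` (q @^-1` [set k])) w = u (q (X 0%N w)).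
  rewrite -[RHS](sum_indic_cells u); apply: eq_bigr => k _.
  by congr (_ * _); exact: (indic_cell k (X 0%N w)).
rewrite indicE.
have [Nw|Nw] := boolP (_ \in _); last first.
  by rewrite mulr0 add0r; apply: fu => h; move/negP: Nw; apply; exact: mem_set.
rewrite mulr1 -addrA (le_trans (ler_norm _))// (le_trans (fM _))// lerDl.
rewrite (bigD1 (q (X 0%N w)))//= addrAC addr_ge0 ?sumr_ge0//.
by rewrite -lerBlDr sub0r -normrN ler_norm.
Qed.

(* a bounds the error of c \o q on the good cells, b the additional error on the
   bad cells Y. *)
Lemma average_sub_mean_le (f : T -> R) (c : K -> R) (Y : pred K) (N : set T)
    (M a b : R) (m : nat) (w : Omega) :
  measurable_fun setT f -> (forall x, `|f x| <= M) -> 0 <= a -> 0 <= b ->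
  measurable N -> P (X 0%N @^-1` N) = 0%E ->
  (forall k, `|c k| <= M) ->
  (forall x, ~ N x -> `|f x - c (q x)| <= a + (Y (q x))%:R * b) ->
  (forall i, ~ N (X i w)) ->
  m%:R^-1 * (\sum_(i < m) f (X i w)) - fine ('E_P[f \o X 0%N])%E <=
  (M + a + b) * (\sum_k
    `|m%:R^-1 * visits R (q @^-1` [set k]) m (sample_path X w) - p k|)
  + 2 * (a + b * prob P (X 0%N @^-1` [set x | Y (q x)])).
Proof.
move=> mf fM a0 b0 mN PN cM fc Nw.
pose h k := a + (Y k)%:R * b.
have h0 k : 0 <= h k by rewrite addr_ge0// mulr_ge0.
have hab k : h k <= a + b by rewrite lerD2l ler_piMl// lern1 leq_b1.
set v := fun k => m%:R^-1 * visits R (q @^-1` [set k]) m (sample_path X w).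
have avg : m%:R^-1 * (\sum_(i < m) f (X i w)) <= \sum_k (c k + h k) * v k.
  rewrite -average_visits ler_wpM2l ?invr_ge0//; apply: ler_sum => i _.
  by have := fc _ (Nw i); rewrite ler_norml => /andP[_]; rewrite lerBlDl.
have mean : - fine ('E_P[f \o X 0%N])%E <= \sum_k (h k - c k) * p k.
  rewrite -(@fine_expectationN _ _ _ P _ M)//; last 2 first.
  - exact: measurableT_comp.
  - by move=> ?; exact: fM.
  apply: (@mean_le (\- f) M _ N) => //.
  - exact: measurableT_comp.
  - by move=> x; rewrite normrN.
  - move=> x /fc; rewrite ler_norml => /andP[+ _].
    by rewrite /= -/(h (q x)); move: (h _) => y; lra.
(* Integrates the pointwise identity [b * Y - h = - a]. *)
have hp : \sum_k h k * p k <= a + b * prob P (X 0%N @^-1` [set x | Y (q x)]).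
  pose A (o : 'I_1 + K) := if o is inr k then X 0%N @^-1` (q @^-1` [set k])
    else X 0%N @^-1` [set x | Y (q x)].
  pose g (o : 'I_1 + K) := if o is inr k then - h k else b.
  have mA o : measurable (A o).
    case: o => [i|k]; apply: measurable_RV_preimage => //.
    exact: (measurable_partition_preimage [set k | Y k] mq).
  have : - a <= \sum_o g o * prob P (A o).
    apply: sum_indic_ge => // x; rewrite big_sumType big_ord1/=.
    have -> : \sum_k - h k * \1_(X 0%N @^-1` (q @^-1` [set k])) x =
        - h (q (X 0%N x)).
      rewrite -[RHS](sum_indic_cells (fun k => - h k)); apply: eq_bigr => k _.
      by congr (_ * _); exact: (indic_cell k (X 0%N x)).
    have -> : \1_(X 0%N @^-1` [set x | Y (q x)]) x = (Y (q (X 0%N x)))%:R :> R.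
      rewrite indicE; congr (nat_of_bool _)%:R.
      by apply/idP/idP => [/set_mem//|?]; exact: mem_set.
    by rewrite mulrC /h opprD addrCA subrr addr0.
  rewrite big_sumType big_ord1/=; under [X in _ + X]eq_bigr do rewrite mulNr.
  by rewrite sumrN lerBrDr addrC lerBlDr addrC.
apply: (le_trans (lerD avg mean)).
(* The error [h] is paid once for the average and once for the mean, hence the factor 2; the rest
   involves only the deviations [v - p]. *)
have -> : \sum_k (c k + h k) * v k + \sum_k (h k - c k) * p k =
    \sum_k (c k + h k) * (v k - p k) + 2 * \sum_k h k * p k.
  rewrite mulr_sumr -!big_split/=; apply: eq_bigr => k _; ring.
apply: lerD; last by rewrite ler_pM2l.
rewrite mulr_sumr; apply: ler_sum => k _.
apply: (le_trans (ler_norm _)); rewrite normrM ler_wpM2r//.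
rewrite (le_trans (ler_normD _ _))// -addrA lerD//.
by rewrite ger0_norm.
Qed.

End averages.

(** * Bound on the asymptotic discrepancy *)

Section asymptotic_discrepancy.
Context d dT (Omega : measurableType d) (T : measurableType dT)
  (R : realType) (P : probability Omega R) (X : nat -> {RV P >-> T}).
Hypotheses (stX : stationary X) (ergX : ergodic X).

Lemma ae_frequencies (K : finType) (q : T -> K) (eta : R) :
  measurable_partition q -> 0 < eta ->
  {ae P, forall w, \forall m \near \oo,
    \sum_k `|m%:R^-1 * visits R (q @^-1` [set k]) m (sample_path X w)
             - prob P (X 0%N @^-1` (q @^-1` [set k]))| <= eta}.
Proof.
(* Each cell will deviate by at most [2 * e], and [#|K| * (2 * e) <= eta]; the successor keeps the
   denominator nonzero. *)
move=> mq eta0; pose e := eta / (2 * #|K|.+1%:R).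
have e0 : 0 < e by rewrite divr_gt0// mulr_gt0.
have := filter_forall (ae_filter_ringOfSetsType P)
  (fun k => ae_visits stX ergX (mq k) e0).
apply: filterS => w hw.
have : \forall m \near \oo, forall k,
    `|m%:R^-1 * visits R (q @^-1` [set k]) m (sample_path X w)
      - prob P (X 0%N @^-1` (q @^-1` [set k]))| <= 2 * e.
  apply: filter_forall => k; have [C hC] := hw k.
  near=> m.
  have m0 : 0 < m%:R :> R by rewrite ltr0n; near: m; exact: nbhs_infty_gt.
  have Cm : C%:R <= m%:R * e.
    by rewrite -ler_pdivrMr//; near: m; exact: nbhs_infty_ger.
  rewrite -(ler_pM2l m0) -[X in X * `|_|]gtr0_norm// -normrM mulrBr.
  rewrite mulVKf ?gt_eqF//; apply: (le_trans (hC m)).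
  by rewrite [leRHS](_ : _ = m%:R * e + m%:R * e) ?lerD2l//; ring.
apply: filterS => m hm; apply: (le_trans (ler_sum _ (fun k _ => hm k))).
rewrite sumr_const -mulr_natl /e.
rewrite [leLHS](_ : _ = eta * (#|K|%:R / #|K|.+1%:R)); last first.
  have : #|K|.+1%:R != 0 :> R by rewrite pnatr_eq0.
  by move: #|K|.+1%:R => n n0; field.
by rewrite ler_piMr ?(ltW eta0)// ler_pdivrMr// mul1r ler_nat.
Unshelve. all: by end_near. Qed.

Lemma stationary_null (N : set T) : measurable N -> P (X 0%N @^-1` N) = 0%E ->
  {ae P, forall w, forall i, ~ N (X i w)}.
Proof.
move=> mN PN; apply: ae_foralln => i; exists (X i @^-1` N); split.
- exact: measurable_RV_preimage.
- apply: prob_eq0; first exact: measurable_RV_preimage.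
  by rewrite (stationary_marginal stX)// /prob PN.
- by move=> w /= h; apply: contrapT => Nw; apply: h.
Qed.

(** Error budget: [8 * gamma] from the oscillation, counted for average and mean, [gamma] from the
    bad cells, and [gamma] from the deviations of finitely many frequencies. *)
Lemma asymptotic_discrepancy_le (F : set (T -> R)) (gamma Gamma : R) :
  countable F -> (forall f, F f -> measurable_fun [set: T] f) ->
  (exists M : R, forall f, F f -> forall x, `|f x| <= M) ->
  0 < gamma -> (gap_dim gamma F < +oo)%E ->
  is_asymptotic_discrepancy F X Gamma -> Gamma <= 10 * gamma.
Proof.
move=> cF mF [M0 FM0] g0 gF [_ aeG].
have [M [M_gt0 FM]] : exists M : R,
    0 < M /\ forall f, F f -> forall x, `|f x| <= M.
  exists (`|M0| + 1); split=> [|f Ff x]; first by rewrite ltr_pwDr.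
  by rewrite (le_trans (FM0 f Ff x))// (le_trans (ler_norm _))// lerDl.
pose mu := distribution P (X 0%N).
(* The bad cells then cost at most [2 * (2 * M * delta) = gamma]. *)
pose delta := gamma / (4 * M).
have d0 : 0 < delta by rewrite divr_gt0// mulr_gt0.
have [K [q [mq hq]]] := uniform_partition mu mF FM g0 gF d0.
(* The factor [M + a + b] of [average_sub_mean_le] for [a = 4 * gamma] and [b = 2 * M]. *)
pose B := M + 4 * gamma + 2 * M.
have B0 : 0 < B by rewrite /B; lra.
pose good f w := exists (Y : pred K) (c : K -> R) (N : set T),
  [/\ measurable N, P (X 0%N @^-1` N) = 0%E,
    prob P (X 0%N @^-1` [set x | Y (q x)]) <= delta,
    forall k, `|c k| <= M &
    (forall x, ~ N x ->
      `|f x - c (q x)| <= 4 * gamma + (Y (q x))%:R * (2 * M)) /\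
    forall i, ~ N (X i w)].
have aeN : {ae P, forall w, forall f, F f -> good f w}.
  (* Countability of [F] yields one null set for all [f]; the partition [q] is already common to
     them. *)
  have /pfcard_geP[->|[e]] := cF; first exact: aeW.
  have Fe n : F (e n) by exact: funS.
  have step n : {ae P, forall w, good (e n) w}.
    have [Y [c [N [mN PN PY cM hc]]]] := hq _ (Fe n).
    apply: filterS (stationary_null mN PN) => w Nw.
    by exists Y, c, N; split.
  apply: filterS (ae_foralln step) => w hw f Ff.
  by have [n _ <-] := surj (f := e) Ff; exact: hw.
have gB : 0 < gamma / B by rewrite divr_gt0.
have PF : ProperFilter (almost_everywhere P).
  have P_gt0 : (0 < P setT)%E by rewrite probability_setT lte01.
  exact: ae_properfilter_algebraOfSetsType.
(* [Gamma] is a constant, so a single good [w] suffices. *)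
have [w [[hN hfreq] hG]] :=
  filter_ex (filterI (filterI aeN (ae_frequencies mq gB)) aeG).
rewrite -(cvg_lim _ hG)//; apply: limr_le; first by apply/cvg_ex; exists Gamma.
apply: filterS hfreq => m hm.
rewrite /discrepancy; set S := [set _ | _ in F].
have [->|S0] := eqVneq S set0; first by rewrite sup0 mulr_ge0// ltW.
apply: ge_sup; first exact/set0P.
move=> _ [f Ff <-].
have [Y [c [N [mN PN PY cM [hc Nw]]]]] := hN f Ff.
have a0 : 0 <= 4 * gamma by rewrite mulr_ge0// ltW.
have b0 : 0 <= 2 * M by rewrite mulr_ge0// ltW.
have mX0 : measurable_fun setT (f \o X 0%N).
  by apply: measurableT_comp => //; exact: mF.
have final : B * (\sum_k
      `|m%:R^-1 * visits R (q @^-1` [set k]) m (sample_path X w)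
        - prob P (X 0%N @^-1` (q @^-1` [set k]))|) +
    2 * (4 * gamma + 2 * M * prob P (X 0%N @^-1` [set x | Y (q x)]))
    <= 10 * gamma.
  move: hm PY; rewrite ler_pdivlMr// mulrC /delta ler_pdivlMr ?mulr_gt0//.
  set z := prob P _; rewrite [z * _]mulrC => h1 h2.
  have e : 2 * (2 * M * z) = 4 * M * z by ring.
  by rewrite mulrDr e; move: h1 h2; move: (B * _) (4 * M * _) => x y; lra.
rewrite ler_norml; apply/andP; split; last first.
  apply: le_trans final.
  exact: (average_sub_mean_le mq m (mF f Ff) (FM f Ff) a0 b0 mN PN cM hc Nw).
(* The lower bound is the upper bound for [- f] and [- c], with the same [Y] and [N]. *)
rewrite lerNl; apply: le_trans final.
have mNf : measurable_fun setT (\- f) by apply: measurable_funN; exact: mF.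
have NfM x : `|(\- f) x| <= M by rewrite normrN; exact: FM.
have NcM k : `|(\- c) k| <= M by rewrite normrN.
have Nhc x : ~ N x ->
    `|(\- f) x - (\- c) (q x)| <= 4 * gamma + (Y (q x))%:R * (2 * M).
  by move=> /hc; rewrite -normrN opprD opprK.
have := average_sub_mean_le mq m mNf NfM a0 b0 mN PN NcM Nhc Nw.
have -> : fine ('E_P[(\- f)%R \o X 0%N])%E = - fine ('E_P[f \o X 0%N])%E.
  by apply: fine_expectationN mX0 _ => x; exact: FM.
by rewrite sumrN mulrN opprK opprB addrC.
Qed.

End asymptotic_discrepancy.

Theorem corollary1 (R : realType) (T : completeMetricType R)
    (sepT : separable T) (F : set (borel T -> R)) (countF : countable F)
    (measF : forall f, F f -> measurable_fun [set: borel T] f)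
    (boundF : exists M : R, forall f, F f -> forall x, `|f x| <= M) :
  (forall gamma : R, 0 < gamma -> (gap_dim gamma F < +oo)%E ->
    forall (d : measure_display) (Omega : measurableType d)
      (P : probability Omega R) (X : nat -> {RV P >-> borel T}),
      stationary X -> ergodic X ->
      forall Gamma : R, is_asymptotic_discrepancy F X Gamma ->
        Gamma <= 10 * gamma)
  /\
  ((forall gamma : R, 0 < gamma -> (gap_dim gamma F < +oo)%E) ->
    forall (d : measure_display) (Omega : measurableType d)
      (P : probability Omega R) (X : nat -> {RV P >-> borel T}),
      stationary X -> ergodic X ->
      forall Gamma : R, is_asymptotic_discrepancy F X Gamma ->
        Gamma = 0).
Proof.
split=> [gamma g0 gF d Omega P X stX ergX Gamma hG|
         gF d Omega P X stX ergX Gamma hG].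
  exact: (asymptotic_discrepancy_le stX ergX countF measF boundF g0 gF hG).
apply/eqP; rewrite eq_le (proj1 hG) andbT.
apply/ler_addgt0Pl => e e0; rewrite addr0 -[e](@divfK _ 10)// mulrC.
have e10 : 0 < e / 10 by rewrite divr_gt0.
exact: (asymptotic_discrepancy_le stX ergX countF measF boundF e10
  (gF _ e10) hG).
Qed.
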